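(* Let $\phi$ be an FO sentence of quantifier depth $q$, and let $G=(V,E)$ be a labeled colored graph with neighborhood diversity at most $w$ and with $l$ labeled vertices. Then there is an algorithm that decides whether $G\models\phi$ in time $O\left((w+l+q)^q\cdot|\phi|\right)$.
   Context: A labeled colored graph is a finite simple undirected graph $G=(V,E)$ together with a finite set of labels, each assigned to a vertex, and a finite collection of (not necessarily disjoint) subsets of $V$ called color classes. FO formulas are built from vertex variables, labels (as constants), color class symbols, atoms $E(s,t)$, $s\in C$, $s=t$, Boolean connectives and quantifiers over vertices, with standard semantics; a sentence has no free variables, and $|\phi|$ is its length. Two vertices $v,v'$ have the same type iff they lie in the same color classes and $N(v)\setminus\{v'\}=N(v')\setminus\{v\}$, where $N(v)$ is the neighborhood of $v$. $G$ has neighborhood diversity at most $w$ if $V$ can be partitioned into at most $w$ sets each consisting of vertices of pairwise the same type. Convention of the paper: such a partition of $V$ into at most $w$ sets is assumed to be given as part of the input. *)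

(* Defs.v *)
From mathcomp Require Import all_boot.

Set Implicit Arguments.
Unset Strict Implicit.
Unset Printing Implicit Defensive.

(** * Labeled colored graphs and neighborhood diversity *)

(* [lab] need not be injective: a vertex may carry several labels. *)
Record lcgraph (V L C : finType) := LCGraph {
  edge : rel V;
  edge_sym : symmetric edge;
  edge_irr : irreflexive edge;
  lab : L -> V;
  col : C -> {set V}
}.

Section Graphs.
Variables V L C : finType.
Implicit Type G : lcgraph V L C.

Definition nbr G (v : V) : {set V} := [set u | edge G v u].

Definition labeled G : {set V} := [set lab G a | a : L].

Definition same_type G (v v' : V) : Prop :=
  (forall c : C, (v \in col G c) = (v' \in col G c)) /\
  nbr G v :\ v' = nbr G v' :\ v.

Definition nd_partition G (w : nat) (P : {set {set V}}) : Prop :=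
  [/\ partition P [set: V], #|P| <= w &
      forall S v v', S \in P -> v \in S -> v' \in S -> same_type G v v'].

(* [B] lists, in an arbitrary order and without repetition, the members of [P],
   each of them given as a list without repetition of its vertices. *)
Definition lists_partition (B : seq (seq V)) (P : {set {set V}}) : Prop :=
  all uniq B /\ perm_eq [seq [set x in b] | b <- B] (enum P).

End Graphs.

(** * First-order logic *)

Inductive term (L : Type) := Var of nat | Lab of L.
Arguments Var {L} x.

Inductive connective := And | Or | Imp | Iff.
Inductive quantifier := Ex | All.

Inductive fo (L C : Type) :=
| AdjF of term L & term L
| ColF of term L & C
| EqF of term L & term L
| NotF of fo L C
| BinF of connective & fo L C & fo L C
| QuantF of quantifier & nat & fo L C.

Section Logic.
Variables L C : Type.

Fixpoint qdepth (phi : fo L C) : nat :=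
  match phi with
  | AdjF _ _ | ColF _ _ | EqF _ _ => 0
  | NotF p => qdepth p
  | BinF _ p r => maxn (qdepth p) (qdepth r)
  | QuantF _ _ p => (qdepth p).+1
  end.

(* Number of symbols, brackets and commas not counted. *)
Fixpoint flen (phi : fo L C) : nat :=
  match phi with
  | AdjF _ _ | ColF _ _ | EqF _ _ => 3
  | NotF p => (flen p).+1
  | BinF _ p r => (flen p + flen r).+1
  | QuantF _ _ p => (flen p).+2
  end.

Definition term_vars (t : term L) : seq nat := if t is Var x then [:: x] else [::].

Fixpoint free_vars (phi : fo L C) : seq nat :=
  match phi with
  | AdjF s t | EqF s t => term_vars s ++ term_vars t
  | ColF s _ => term_vars s
  | NotF p => free_vars p
  | BinF _ p r => free_vars p ++ free_vars r
  | QuantF _ x p => [seq y <- free_vars p | y != x]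
  end.

Definition sentence (phi : fo L C) : Prop := free_vars phi = [::].

End Logic.

Definition conn_sem (k : connective) (a b : bool) : bool :=
  match k with
  | And => a && b
  | Or => a || b
  | Imp => a ==> b
  | Iff => a == b
  end.

Section Semantics.
Variables (V L C : finType) (G : lcgraph V L C).

(* Environments are partial so that the empty graph needs no special case.
   Atoms with an unbound variable are false; none occurs when a sentence is
   evaluated in the empty environment. *)
Definition env := nat -> option V.

Definition upd (e : env) (x : nat) (v : V) : env :=
  fun y => if y == x then Some v else e y.

Definition term_sem (e : env) (t : term L) : option V :=
  match t with Var x => e x | Lab a => Some (lab G a) end.

Fixpoint sat (e : env) (phi : fo L C) : bool :=
  match phi with
  | AdjF s t =>
      if (term_sem e s, term_sem e t) is (Some u, Some v) then edge G u v
      else false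
  | ColF s c => if term_sem e s is Some u then u \in col G c else false
  | EqF s t =>
      if (term_sem e s, term_sem e t) is (Some u, Some v) then u == v
      else false
  | NotF p => ~~ sat e p
  | BinF k p r => conn_sem k (sat e p) (sat e r)
  | QuantF Ex x p => [exists v : V, sat (upd e x v) p]
  | QuantF All x p => [forall v : V, sat (upd e x v) p]
  end.

Definition models (phi : fo L C) : bool := sat (fun _ => None) phi.

End Semantics.

(** * Random access machine *)

(* A unit-cost RAM with structured control flow.  The work memory consists of
   arrays of natural numbers; a program mentions finitely many arrays, so they
   can be interleaved in a single memory at constant overhead.  Multiplication
   is not a unit-cost operation.  The input is read-only and randomly
   accessible, one access costing one unit. *)
Inductive port :=
| PVertices | PLabels | PColors | PEdge | PColor | PLabel
| PBlocks | PBlockSize | PBlockVertex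
| PFormulaSize | PFormula.

Definition input := port -> nat -> nat -> nat.

Inductive expr :=
| Const of nat
| Get of nat & expr                  (* array, index *)
| Read of port & expr & expr
| Add of expr & expr
| Sub of expr & expr                 (* truncated *)
| Eqb of expr & expr
| Leb of expr & expr.

Inductive cmd :=
| Skip
| Put of nat & expr & expr           (* array, index, value *)
| Seq of cmd & cmd
| If of expr & cmd & cmd
| While of expr & cmd.

Definition store := nat -> nat -> nat.

Definition put (s : store) (a i x : nat) : store :=
  fun b j => if (b == a) && (j == i) then x else s b j.

Fixpoint eval (I : input) (s : store) (e : expr) : nat :=
  match e with
  | Const k => k
  | Get a i => s a (eval I s i)
  | Read p i j => I p (eval I s i) (eval I s j)
  | Add x y => eval I s x + eval I s y
  | Sub x y => eval I s x - eval I s y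
  | Eqb x y => eval I s x == eval I s y
  | Leb x y => eval I s x <= eval I s y
  end.

Fixpoint ecost (e : expr) : nat :=
  match e with
  | Const _ => 1
  | Get _ i => (ecost i).+1
  | Read _ x y | Add x y | Sub x y | Eqb x y | Leb x y =>
      (ecost x + ecost y).+1
  end.

(* [run I c s t s']: on input [I], started in [s], the command [c] halts in [s']
   after exactly [t] time units. *)
Inductive run (I : input) : cmd -> store -> nat -> store -> Prop :=
| RunSkip s : run I Skip s 1 s
| RunPut a i e s :
    run I (Put a i e) s (ecost i + ecost e).+1 (put s a (eval I s i) (eval I s e))
| RunSeq c d s t s1 u s2 :
    run I c s t s1 -> run I d s1 u s2 -> run I (Seq c d) s (t + u) s2
| RunIf e c d s t s1 :
    run I (if eval I s e != 0 then c else d) s t s1 ->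
    run I (If e c d) s (ecost e + t).+1 s1
| RunWhileEnd e c s :
    eval I s e = 0 -> run I (While e c) s (ecost e).+1 s
| RunWhileStep e c s t s1 u s2 :
    eval I s e != 0 -> run I c s t s1 -> run I (While e c) s1 u s2 ->
    run I (While e c) s (ecost e + t + u).+1 s2.

Lemma run_det I c s t1 s1 t2 s2 :
  run I c s t1 s1 -> run I c s t2 s2 -> t1 = t2 /\ s1 = s2.
Proof.
move=> H1; elim: H1 t2 s2 => {c s t1 s1};
  intros; match goal with H : run I _ _ ?t _ |- _ = ?t /\ _ => inversion H end;
  subst;
  repeat match goal with
  | IH : forall t s, run I ?c ?x t s -> _, H : run I ?c ?x _ _ |- _ =>
      case: (IH _ _ H) => ? ?; subst; clear H
  | E : is_true (eval I ?s ?e != 0), F : eval I ?s ?e = 0 |- _ =>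
      by rewrite F in E
  end; by [].
Qed.

(* The work memory is initially zero; the answer is left in cell 0 of array 0. *)
Definition decides_in (c : cmd) (I : input) (answer : bool) (T : nat) : Prop :=
  exists t s, [/\ run I c (fun _ _ => 0) t s, t <= T & s 0 0 = answer :> nat].

(** * Input of the machine *)

Section Input.
Variables n k m : nat.
Implicit Type t : term 'I_k.

Definition term_code t : seq nat :=
  match t with Var x => [:: 0; x] | Lab a => [:: 1; val a] end.

Definition conn_code (b : connective) : nat :=
  match b with And => 4 | Or => 5 | Imp => 6 | Iff => 7 end.

Definition quant_code (b : quantifier) : nat :=
  match b with Ex => 8 | All => 9 end.

(* Polish notation. *)
Fixpoint code (phi : fo 'I_k 'I_m) : seq nat :=
  match phi with
  | AdjF s t => 1 :: term_code s ++ term_code t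
  | ColF s c => 2 :: rcons (term_code s) (val c)
  | EqF s t => 0 :: term_code s ++ term_code t
  | NotF p => 3 :: code p
  | BinF b p r => conn_code b :: code p ++ code r
  | QuantF b x p => quant_code b :: x :: code p
  end.

(* Adjacency and color classes are given by their 0/1 matrices, the labels by an
   array of vertices, the partition by arrays listing its blocks.  Accesses out
   of range return 0, and unused indices are ignored. *)
Definition instance (G : lcgraph 'I_n 'I_k 'I_m) (B : seq (seq 'I_n))
    (phi : fo 'I_k 'I_m) : input :=
  fun p i j =>
  match p with
  | PVertices => n
  | PLabels => k
  | PColors => m
  | PEdge =>
      if (insub i, insub j) is (Some u, Some v) then nat_of_bool (edge G u v) else 0
  | PColor =>
      if (insub i, insub j) is (Some c, Some v) then nat_of_bool (v \in col G c)
      else 0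
  | PLabel => if insub i is Some a then val (lab G a) else 0
  | PBlocks => size B
  | PBlockSize => size (nth [::] B i)
  | PBlockVertex => nth 0 [seq val v | v <- nth [::] B i] j
  | PFormulaSize => size (code phi)
  | PFormula => nth 0 (code phi) i
  end.

End Input.

(* Main.v *)
(* By the type condition, exchanging two vertices of the same block is an
   automorphism of the graph without its labels. Hence a quantifier only has to
   be tested on the labeled vertices, on the vertices bound by the enclosing
   quantifiers, and on one further vertex of each block, if there is any: at most
   w + l + q vertices in all. Scanning the blocks for these further vertices
   passes over each labeled or bound vertex at most once. As the number of labels
   may be much larger than l and |phi|, only vertices whose label occurs in the
   code of phi are collected, and each of them once. The recursion is carried
   out by a stack machine whose step is a loop-free program, so that the running
   time is proportional to the number of its steps. *)

Require Import Defs.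
From mathcomp Require Import all_boot perm zify.

Set Implicit Arguments.
Unset Strict Implicit.
Unset Printing Implicit Defensive.

(** * Loop-free programs and loops *)

Fixpoint loopfree (c : cmd) : bool :=
  match c with
  | Skip | Put _ _ _ => true
  | Seq c d | If _ c d => loopfree c && loopfree d
  | While _ _ => false
  end.

Section LoopFree.
Variable I : input.
Implicit Types (s : store) (Q : store -> Prop).

(** The value on [While] is a dummy: [exec] turns [run] into computation for loop-free commands
    only. *)
Fixpoint exec (c : cmd) (s : store) : store :=
  match c with
  | Skip | While _ _ => s
  | Put a i e => put s a (eval I s i) (eval I s e)
  | Seq c d => exec d (exec c s)
  | If e c d => if eval I s e != 0 then exec c s else exec d s
  end.

(** The bound does not depend on the store, so one round of a loop with loop-free body takes
    constant time. *)
Fixpoint maxcost (c : cmd) : nat :=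
  match c with
  | Skip | While _ _ => 1
  | Put _ i e => (ecost i + ecost e).+1
  | Seq c d => maxcost c + maxcost d
  | If e c d => (ecost e + maxn (maxcost c) (maxcost d)).+1
  end.

Lemma run_loopfree c s :
  loopfree c -> exists2 t, t <= maxcost c & run I c s t (exec c s).
Proof.
elim: c s => [|a i e|c IHc d IHd|e c IHc d IHd|e c IHc] s //=.
- by exists 1 => //; constructor.
- by move=> _; exists (ecost i + ecost e).+1 => //; constructor.
- case/andP=> /(IHc s)[t le_t run_c] /(IHd (exec c s))[u le_u run_d].
  by exists (t + u); [apply: leq_add | apply: RunSeq run_c run_d].
case/andP=> /(IHc s)[t le_t run_c] /(IHd s)[u le_u run_d].
case E: (eval I s e != 0).
  exists (ecost e + t).+1; first by lia.
  by apply: RunIf; rewrite E.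
exists (ecost e + u).+1; first by lia.
by apply: RunIf; rewrite E.
Qed.

Section Loop.
Variables (e : expr) (c : cmd).

Inductive reach : nat -> store -> store -> Prop :=
| Reach0 s : reach 0 s s
| ReachS n s s' : eval I s e != 0 -> reach n (exec c s) s' -> reach n.+1 s s'.

Lemma reach_trans a b s1 s2 s3 :
  reach a s1 s2 -> reach b s2 s3 -> reach (a + b) s1 s3.
Proof.
by elim=> {a s1 s2} // a s1 s2 nz _ IH r; rewrite addSn; apply: ReachS (IH r).
Qed.

(** A total correctness statement whose budget [T] counts rounds of the loop, not time units. The
    final store need not be halting, so such statements compose. *)
Definition leads (T : nat) (s : store) (Q : store -> Prop) : Prop :=
  exists t s', [/\ reach t s s', t <= T & Q s'].

Lemma leads0 s Q : Q s -> leads 0 s Q.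
Proof. by move=> q; exists 0, s; split=> //; constructor. Qed.

Lemma leads1 s Q : eval I s e != 0 -> Q (exec c s) -> leads 1 s Q.
Proof.
by move=> nz q; exists 1, (exec c s); split=> //; apply: ReachS nz (Reach0 _).
Qed.

Lemma leads_seq T U s Q1 Q2 :
  leads T s Q1 -> (forall s', Q1 s' -> leads U s' Q2) -> leads (T + U) s Q2.
Proof.
case=> t [s1 [r1 le_t /[swap] h /h[u [s2 [r2 le_u q2]]]]].
by exists (t + u), s2; split=> //; [apply: reach_trans r1 r2 | apply: leq_add].
Qed.

Lemma leads_le T U s Q : T <= U -> leads T s Q -> leads U s Q.
Proof. by move=> le_TU [t [s' [r le_t q]]]; exists t, s'; split=> //; lia. Qed.

(** Each round costs at most one test, the body and one unit; the extra one in [T.+1] pays for the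
    last, failing test. *)
Lemma run_while T s Q :
  loopfree c -> leads T s Q -> (forall s', Q s' -> eval I s' e = 0) ->
  exists t s', [/\ run I (While e c) s t s',
                   t <= T.+1 * (ecost e + maxcost c).+1 & Q s'].
Proof.
move=> lf [t [s' [r le_t q]]] halt.
suff [u le_u ru]: exists2 u, u <= t.+1 * (ecost e + maxcost c).+1 &
    run I (While e c) s u s'.
  by exists u, s'; split=> //; apply: leq_trans le_u _; rewrite leq_mul2r ltnS le_t orbT.
elim: r q {le_t} => {t s s'} [s | t s s' nz _ IH] q.
  by exists (ecost e).+1; [lia | apply: RunWhileEnd (halt _ q)].
have [u le_u ru] := IH q.
have [v le_v rv] := run_loopfree s lf.
by exists (ecost e + v + u).+1; [rewrite mulSn; lia | apply: RunWhileStep rv ru].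
Qed.

End Loop.

End LoopFree.

(** * Vertices of the same type *)

Section Twins.
Variables (n k m : nat) (G : lcgraph 'I_n 'I_k 'I_m).
Implicit Types (e : env 'I_n) (u v : 'I_n) (phi : fo 'I_k 'I_m).

(** Labels are required to be fixed as soon as their number occurs anywhere in [code phi], even as a
    variable or symbol: this is the superset that the program collects without parsing. The
    environments are related pointwise, which avoids functional extensionality. *)
Lemma sat_automorphism (f : 'I_n -> 'I_n) phi e e' :
  involutive f -> {mono f : u v / edge G u v} ->
  (forall c, {mono f : v / v \in col G c}) ->
  (forall a : 'I_k, val a \in code phi -> f (lab G a) = lab G a) ->
  (forall x, e' x = omap f (e x)) -> sat G e' phi = sat G e phi.
Proof.
move=> fK fE fC.
have term_f t e1 e2 : (forall a : 'I_k, val a \in term_code t -> f (lab G a) = lab G a) ->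
    (forall x, e2 x = omap f (e1 x)) -> term_sem G e2 t = omap f (term_sem G e1 t).
  case: t => [x | a] fL e12 /=; first exact: e12.
  by rewrite fL // !inE eqxx orbT.
elim: phi e e' => [s t | s c | s t | p IH | b p IHp r IHr | b x p IH] e e' fL ee' /=.
- have fs : forall a : 'I_k, val a \in term_code s -> f (lab G a) = lab G a.
    by move=> a h; apply: fL; rewrite /= inE mem_cat h orbT.
  have ft : forall a : 'I_k, val a \in term_code t -> f (lab G a) = lab G a.
    by move=> a h; apply: fL; rewrite /= inE mem_cat h !orbT.
  rewrite (term_f _ _ _ fs ee') (term_f _ _ _ ft ee').
  by case: (term_sem G e s) => [u|] //=; case: (term_sem G e t) => [v|] //=; apply: fE.
- have fs : forall a : 'I_k, val a \in term_code s -> f (lab G a) = lab G a.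
    by move=> a h; apply: fL; rewrite /= inE mem_rcons inE h !orbT.
  by rewrite (term_f _ _ _ fs ee'); case: (term_sem G e s) => [u|] //=; apply: fC.
- have fs : forall a : 'I_k, val a \in term_code s -> f (lab G a) = lab G a.
    by move=> a h; apply: fL; rewrite /= inE mem_cat h orbT.
  have ft : forall a : 'I_k, val a \in term_code t -> f (lab G a) = lab G a.
    by move=> a h; apply: fL; rewrite /= inE mem_cat h !orbT.
  rewrite (term_f _ _ _ fs ee') (term_f _ _ _ ft ee').
  case: (term_sem G e s) => [u|] //=; case: (term_sem G e t) => [v|] //=.
  by rewrite (inj_eq (inv_inj fK)).
- by rewrite (IH e e') // => a h; apply: fL; rewrite /= inE h orbT.
- rewrite (IHp e e') ?(IHr e e') // => a h; apply: fL;
    by rewrite /= inE mem_cat h !orbT.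
(* At a quantifier, [v] on one side corresponds to [f v] on the other; as [f] is an involution, this
   covers all vertices. *)
have IHx v : sat G (upd e' x (f v)) p = sat G (upd e x v) p.
  apply: IH => [a h | y]; first by apply: fL; rewrite /= !inE h !orbT.
  by rewrite /upd; case: eqP.
case: b {fL}.
  by apply/existsP/existsP => -[v h]; exists (f v); rewrite ?IHx // -IHx fK.
by apply/forallP/forallP => h v; rewrite -?(IHx v) // -[v]fK IHx.
Qed.

(** Outside the pair, [u] and [v] have the same neighbors; the pair itself is reversed, which
    symmetry absorbs, and loops are excluded. *)
Lemma edge_tperm u v : same_type G u v -> {mono tperm u v : x y / edge G x y}.
Proof.
move=> [_ /setP nuv].
have tw z : z != u -> z != v -> edge G u z = edge G v z.
  by move=> zu zv; have := nuv z; rewrite !inE zu zv.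
have twl z : z != u -> z != v -> edge G z u = edge G z v.
  by move=> zu zv; rewrite ![edge G z _]edge_sym tw.
move=> x y; case: tpermP => [->|->|/eqP xu /eqP xv]; case: tpermP => [->|->|/eqP yu /eqP yv];
  by [rewrite !edge_irr | rewrite edge_sym | rewrite tw | rewrite twl | ].
Qed.

(** The transposition of [u] and [v] moves nothing listed in [os], hence none of the relevant
    labeled vertices and none of the bound ones. *)
Lemma sat_twins e x u v phi (os : seq (option 'I_n)) :
  same_type G u v -> Some u \notin os -> Some v \notin os ->
  (forall a : 'I_k, val a \in code phi -> Some (lab G a) \in os) ->
  (forall y z, e y = Some z -> Some z \in os) ->
  sat G (upd e x u) phi = sat G (upd e x v) phi.
Proof.
move=> uv nu nv labs bound.
have fix_os z : Some z \in os -> tperm u v z = z.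
  by move=> zos; apply: tpermD; apply: contraTneq zos => <-.
apply: (@sat_automorphism (tperm u v)).
- exact: tpermK.
- exact: edge_tperm.
- by case: uv => uvC _ c z; case: tpermP => [->|->|].
- by move=> a /labs/fix_os.
move=> y; rewrite /upd; case: eqP => _; first by rewrite /= tpermR.
by case E: (e y) => [z|] //=; rewrite fix_os // (bound _ _ E).
Qed.

(** [None] is the dummy candidate of the machine and never counts as a witness. *)
Definition hits (Q : pred 'I_n) (o : option 'I_n) : bool :=
  if o is Some v then Q v else false.

Definition fresh (os : seq (option 'I_n)) (b : seq 'I_n) : option 'I_n :=
  ohead [seq v <- b | Some v \notin os].

Variables (P : {set {set 'I_n}}) (B : seq (seq 'I_n)).
Hypotheses (BP : lists_partition B P) (partP : partition P [set: 'I_n]).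
Hypothesis typP :
  forall S v v', S \in P -> v \in S -> v' \in S -> same_type G v v'.

Lemma size_blocks : size B = #|P|.
Proof. by case: BP => _ /perm_size; rewrite size_map -cardE. Qed.

Lemma block_type b u v : b \in B -> u \in b -> v \in b -> same_type G u v.
Proof.
move=> bB ub vb; apply: (typP (S := [set x in b])); rewrite ?inE //.
case: BP => _ /perm_mem/(_ [set x in b]); rewrite mem_enum => <-.
exact: map_f bB.
Qed.

Lemma block_of v : exists2 b, b \in B & v \in b.
Proof.
have : v \in cover P by rewrite (cover_partition partP) inE.
case/bigcupP=> S SP vS; have : S \in [seq [set x in b] | b <- B].
  by case: BP => _ /perm_mem ->; rewrite mem_enum.
by case/mapP=> b bB S_b; exists b; rewrite // S_b inE in vS.
Qed.

(** The list contains all [n] vertices, and its length is the sum of the cardinalities of the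
    blocks, which is [n] for a partition. *)
Lemma uniq_flatten_blocks : uniq (flatten B).
Proof.
apply/card_uniqP.
have -> : #|flatten B| = n.
  rewrite -[RHS]card_ord; apply: eq_card => v; rewrite [RHS]inE.
  by have [b bB vb] := block_of v; apply/flattenP; exists b.
rewrite -[LHS]card_ord -cardsT (card_partition partP) -big_enum /=.
case: BP => uB pB; rewrite -(perm_big _ pB) /= big_map size_flatten sumnE big_map.
rewrite !big_seq; apply: eq_bigr => b bB.
by rewrite cardsE; apply/esym/esym/card_uniqP/(allP uB).
Qed.

(** This amortizes the scan: the old vertices skipped in all blocks together number at most
    [size os], since no vertex is listed twice. *)
Lemma count_old os :
  count (fun v => Some v \in os) (flatten B) <= size os.
Proof.
rewrite -size_filter -(size_map Some); apply: uniq_leq_size.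
  by rewrite (map_inj_uniq (@Some_inj _)) filter_uniq ?uniq_flatten_blocks.
by move=> o /mapP[v]; rewrite mem_filter => /andP[h _] ->.
Qed.

(** A witness outside [os] lies in some block, and the first fresh vertex of that block has the same
    type, so it is a witness too. *)
Lemma exists_hits (Q : pred 'I_n) os :
  (forall u v, same_type G u v -> Some u \notin os -> Some v \notin os -> Q u = Q v) ->
  [exists v, Q v] = has (hits Q) os || has (fun b => hits Q (fresh os b)) B.
Proof.
move=> twins; apply/existsP/orP => [[v Qv] | [/hasP[[v|] // _] | /hasP[b _]]].
- have [v_os | v_os] := boolP (Some v \in os).
    by left; apply/hasP; exists (Some v).
  right; have [b bB vb] := block_of v; apply/hasP; exists b => //.
  rewrite /fresh; case E: [seq _ <- b | _] => [|u b'] /=.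
    have : v \in [seq v <- b | Some v \notin os] by rewrite mem_filter v_os.
    by rewrite E.
  have : u \in [seq v <- b | Some v \notin os] by rewrite E mem_head.
  rewrite mem_filter => /andP[u_os ub].
  by rewrite (twins u v) //; apply: block_type ub vb.
- by move=> Qv; exists v.
by case: (fresh os b) => [v|] //= Qv; exists v.
Qed.

End Twins.

(** * The program *)

Section Memory.
Variable I : input.
Implicit Types (s : store) (r cs fr : seq nat) (ev : nat -> nat)
  (stk : seq (seq nat)) (Q : store -> Prop).

Fixpoint frames s stk : Prop :=
  if stk is fr :: stk' then
    (forall f, f < size fr -> s (8 + f) (size stk) = nth 0 fr f) /\ frames s stk'
  else True.

(* The top frame may be shorter than the eight arrays reserved for it: the
   missing fields are unspecified. *)
Record stores s r ev cs stk : Prop := Stores {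
  stores_reg : forall i, i < 5 -> s 0 i = nth 0 r i;
  stores_sp : s 0 5 = size stk;
  stores_nc : s 0 6 = size cs;
  stores_env : forall x, s 1 x = ev x;
  stores_mark : forall v, s 2 v = count_mem v cs;
  stores_cand : forall i, i < size cs -> s 3 i = nth 0 cs i;
  stores_frames : frames s stk
}.

(** * Preservation of the memory invariant under single writes *)

Lemma frames_eq s s' stk :
  (forall a i, 8 <= a -> 0 < i <= size stk -> s' a i = s a i) ->
  frames s stk -> frames s' stk.
Proof.
elim: stk => //= fr stk IH ss' [top rest]; split=> [f lt_f|].
  by rewrite ss' ?top //= ?leqnn.
by apply: IH rest => a i a8 /andP[i0 le_i]; apply: ss'; rewrite ?i0 // ltnW.
Qed.

Lemma frames_put s a i x stk : a < 8 -> frames s stk -> frames (put s a i x) stk.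
Proof. by move=> a8; apply: frames_eq => b j b8 _; rewrite /put; case: eqP => //; lia. Qed.

Lemma stores_put_reg s r ev cs stk i x :
  i < 5 -> stores s r ev cs stk -> stores (put s 0 i x) (set_nth 0 r i x) ev cs stk.
Proof.
move=> i5 [h1 h2 h3 h4 h5 h6 h7]; split=> //; try by rewrite /put /=; case: eqP => //; lia.
- by move=> j j5; rewrite nth_set_nth /= /put /=; case: eqP => // _; apply: h1.
by apply: frames_put.
Qed.

Lemma stores_put_env s r ev cs stk x y :
  stores s r ev cs stk -> stores (put s 1 x y) r (fun z => if z == x then y else ev z) cs stk.
Proof.
move=> [h1 h2 h3 h4 h5 h6 h7]; split=> //; last by apply: frames_put.
by move=> z; rewrite /put /=; case: eqP.
Qed.

Lemma stores_env_eq s r ev ev' cs stk :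
  ev =1 ev' -> stores s r ev cs stk -> stores s r ev' cs stk.
Proof. by move=> eq_ev [h1 h2 h3 h4 h5 h6 h7]; split=> // x; rewrite h4. Qed.

Lemma stores_push s r ev cs stk :
  stores s r ev cs stk -> stores (put s 0 5 (size stk).+1) r ev cs ([::] :: stk).
Proof.
move=> [h1 h2 h3 h4 h5 h6 h7]; split=> //; last by split=> //; apply: frames_put.
by move=> j j5; rewrite /put /=; case: eqP; [lia | rewrite h1].
Qed.

Lemma stores_pop s r ev cs fr stk :
  stores s r ev cs (fr :: stk) -> stores (put s 0 5 (size stk)) r ev cs stk.
Proof.
move=> [h1 h2 h3 h4 h5 h6 [_ h7]]; split=> //; last by apply: frames_put.
by move=> j j5; rewrite /put /=; case: eqP; [lia | rewrite h1].
Qed.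

(** The case [f = size fr] extends the frame by one field, so a new frame is filled from left to
    right. *)
Lemma stores_put_frame s r ev cs fr stk f x :
  f <= size fr -> stores s r ev cs (fr :: stk) ->
  stores (put s (8 + f) (size stk).+1 x) r ev cs (set_nth 0 fr f x :: stk).
Proof.
move=> le_f [h1 h2 h3 h4 h5 h6 [top rest]]; split=> //; split.
  move=> g; rewrite size_set_nth nth_set_nth /= => lt_g.
  rewrite /put eqxx andbT eqn_add2l; case: eqP => // ne.
  by apply: top; lia.
apply: frames_eq rest => a i a8 /andP[_ le_i]; rewrite /put.
by case: (i =P _); [lia | rewrite andbF].
Qed.

Lemma stores_take_frame s r ev cs fr stk f :
  stores s r ev cs (fr :: stk) -> stores s r ev cs (take f fr :: stk).
Proof.
move=> [h1 h2 h3 h4 h5 h6 [top rest]]; split=> //; split=> // g.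
rewrite size_take_min leq_min => /andP[lt_gf lt_g].
by rewrite nth_take // top.
Qed.

(** Multiplicities are kept instead of flags because an old candidate that is bound again occurs
    twice, and must stay marked when the second occurrence is removed. *)
Lemma stores_push_cand s r ev cs stk c :
  stores s r ev cs stk ->
  stores (put (put (put s 3 (size cs) c) 2 c (count_mem c cs).+1) 0 6 (size cs).+1)
    r ev (rcons cs c) stk.
Proof.
move=> [h1 h2 h3 h4 h5 h6 h7]; split=> //.
- by move=> i i5; rewrite /put /=; case: eqP => [|_]; [lia | apply: h1].
- by rewrite size_rcons.
- move=> v; rewrite -cats1 count_cat /= addn0 /put /= [c == v]eq_sym.
  by case: eqP => [->|_]; rewrite ?addn1 ?addn0 // h5.
- move=> i; rewrite size_rcons ltnS nth_rcons /put /= => le_i.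
  case: ltngtP le_i => //= lt_i _; exact: h6.
by do !apply: frames_put.
Qed.

Lemma stores_pop_cand s r ev cs stk c :
  stores s r ev (rcons cs c) stk ->
  stores (put (put s 2 c (count_mem c cs)) 0 6 (size cs)) r ev cs stk.
Proof.
move=> [h1 h2 h3 h4 h5 h6 h7]; split=> //.
- by move=> i i5; rewrite /put /=; case: eqP => [|_]; [lia | apply: h1].
- move=> v; rewrite /put /=; case: eqP => [->|/eqP ne] //=.
  by rewrite h5 -cats1 count_cat /= eq_sym (negbTE ne) !addn0.
- move=> i lt_i; rewrite /put /= h6 ?size_rcons 1?ltnW //.
  by rewrite nth_rcons lt_i.
by do !apply: frames_put.
Qed.

(* Array 0 holds the registers: 0 truth value of the last evaluated formula,
   1 position in the code, 2 mode (0 return, 1 evaluate, 2 try the next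
   candidate), 3 and 4 scratch, 5 height of the stack, 6 number of candidates.
   Array 1 is the environment, array 3 the list of candidates, and array 2 gives
   the multiplicity of each value in that list; vertex v is stored as v + 1, and
   0 stands for an unbound variable.  The arrays 8 to 15 are the fields of the
   stack frames, indexed by the height: 8 code of the symbol (increased by 6 once
   the left operand is known), 9 value of the left operand, or whether a vertex
   deciding the quantifier was found, 10 position of the body, 11 variable,
   12 next candidate, 13 block, 14 index in the block, 15 value of the variable
   outside the body. *)

Definition reg i := Get 0 (Const i).
Definition setr i e := Put 0 (Const i) e.
Definition symbol i := Read PFormula (Add (reg 1) (Const i)) (Const 0).
Definition field a := Get a (reg 5).
Definition setf a e := Put a (reg 5) e.
Definition pop := setr 5 (Defs.Sub (reg 5) (Const 1)).
Definition push_cand :=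
  Seq (Put 3 (reg 6) (reg 3))
    (Seq (Put 2 (reg 3) (Add (Get 2 (reg 3)) (Const 1)))
      (setr 6 (Add (reg 6) (Const 1)))).
Definition pop_cand :=
  Seq (Put 2 (reg 3) (Defs.Sub (Get 2 (reg 3)) (Const 1)))
    (setr 6 (Defs.Sub (reg 6) (Const 1))).

Definition load i off :=
  If (symbol off) (setr i (Add (Read PLabel (symbol off.+1) (Const 0)) (Const 1)))
    (setr i (Get 1 (symbol off.+1))).

(** Serves adjacency (code 1) and equality (code 0) alike, both of which occupy five numbers of the
    code. *)
Definition atom2 :=
  Seq (load 3 1) (Seq (load 4 3) (Seq
    (If (Eqb (reg 3) (Const 0)) (setr 0 (Const 0))
      (If (Eqb (reg 4) (Const 0)) (setr 0 (Const 0))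
        (If (symbol 0)
          (setr 0 (Read PEdge (Defs.Sub (reg 3) (Const 1)) (Defs.Sub (reg 4) (Const 1))))
          (setr 0 (Eqb (reg 3) (reg 4))))))
    (Seq (setr 1 (Add (reg 1) (Const 5))) (setr 2 (Const 0))))).

Definition atom1 :=
  Seq (load 3 1) (Seq
    (If (Eqb (reg 3) (Const 0)) (setr 0 (Const 0))
       (setr 0 (Read PColor (symbol 3) (Defs.Sub (reg 3) (Const 1)))))
    (Seq (setr 1 (Add (reg 1) (Const 4))) (setr 2 (Const 0)))).

Definition enter_quant :=
  Seq (setf 9 (Const 0)) (Seq (setf 10 (Add (reg 1) (Const 2)))
    (Seq (setf 11 (symbol 1)) (Seq (setf 12 (Const 0)) (Seq (setf 13 (Const 0))
      (Seq (setf 14 (Const 0)) (setr 2 (Const 2))))))).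

Definition eval_cmd :=
  If (Leb (symbol 0) (Const 1)) atom2 (If (Eqb (symbol 0) (Const 2)) atom1
    (Seq (setr 5 (Add (reg 5) (Const 1))) (Seq (setf 8 (symbol 0))
      (If (Leb (symbol 0) (Const 7)) (setr 1 (Add (reg 1) (Const 1))) enter_quant)))).

(** The codes 10 to 13 are those of the four connectives raised by 6; on values 0 and 1 each
    connective is an arithmetic comparison. *)
Definition apply_connective (k : expr -> cmd) :=
  If (Eqb (field 8) (Const 10)) (k (Eqb (Add (field 9) (reg 0)) (Const 2)))
    (If (Eqb (field 8) (Const 11)) (k (Leb (Const 1) (Add (field 9) (reg 0))))
      (If (Eqb (field 8) (Const 12)) (k (Leb (field 9) (reg 0)))
        (k (Eqb (field 9) (reg 0))))).

(** The test on register 3 discards the dummy candidate. A vertex is deciding if the body is true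
    under an existential, or false under a universal quantifier. *)
Definition leave_body :=
  Seq (setr 3 (Get 1 (field 11))) (Seq (Put 1 (field 11) (field 15)) (Seq pop_cand
    (Seq (If (reg 3) (If (Eqb (reg 0) (Eqb (field 8) (Const 8)))
                       (setf 9 (Const 1)) Skip) Skip)
      (setr 2 (Const 2))))).

Definition return_cmd :=
  If (Eqb (field 8) (Const 3)) (Seq (setr 0 (Defs.Sub (Const 1) (reg 0))) pop)
    (If (Leb (field 8) (Const 7))
      (Seq (setf 9 (reg 0)) (Seq (setf 8 (Add (field 8) (Const 6))) (setr 2 (Const 1))))
      (If (Leb (field 8) (Const 9)) leave_body (Seq (apply_connective (setr 0)) pop))).

Definition enter_body :=
  Seq (setf 15 (Get 1 (field 11))) (Seq (Put 1 (field 11) (reg 3)) (Seq push_cand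
    (Seq (setr 1 (field 10)) (setr 2 (Const 1))))).

Definition next_block :=
  Seq (setf 13 (Add (field 13) (Const 1))) (setf 14 (Const 0)).

(** Old candidates come first, then the blocks. A fresh vertex ends the scan of its block at once,
    the other fresh ones being exchangeable with it. *)
Definition next_cmd :=
  If (Leb (Add (field 12) (Const 1)) (reg 6))
    (Seq (setr 3 (Get 3 (field 12))) (Seq (setf 12 (Add (field 12) (Const 1))) enter_body))
  (If (Leb (Add (field 13) (Const 1)) (Read PBlocks (Const 0) (Const 0)))
    (If (Leb (Add (field 14) (Const 1)) (Read PBlockSize (field 13) (Const 0)))
      (Seq (setr 3 (Add (Read PBlockVertex (field 13) (field 14)) (Const 1)))
        (If (Get 2 (reg 3)) (setf 14 (Add (field 14) (Const 1)))
          (Seq next_block enter_body)))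
      next_block)
    (Seq (setr 0 (Eqb (field 9) (Eqb (field 8) (Const 8)))) (Seq pop (setr 2 (Const 0))))).

Definition machine_body :=
  If (Eqb (reg 2) (Const 1)) eval_cmd
    (If (Eqb (reg 2) (Const 2)) next_cmd return_cmd).

(** Zero exactly in return mode with an empty stack, when the whole sentence has its value. *)
Definition machine_cond := Add (reg 2) (reg 5).

Definition collect_cond := Defs.Sub (Read PFormulaSize (Const 0) (Const 0)) (reg 1).
(* Every number of the code is taken for a label; a variable mistaken for a label
   contributes a labeled vertex all the same. *)
Definition collect_body :=
  Seq (setr 4 (symbol 0)) (Seq (setr 1 (Add (reg 1) (Const 1)))
   (If (Leb (Add (reg 4) (Const 1)) (Read PLabels (Const 0) (Const 0)))
     (Seq (setr 3 (Add (Read PLabel (reg 4) (Const 0)) (Const 1)))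
       (If (Get 2 (reg 3)) Skip push_cand)) Skip)).

(* The first candidate leaves the variable unbound: it is ignored in the result,
   but guarantees that the body is traversed at least once, even if there is no
   vertex, and this is how the machine finds the end of the body. *)
Definition program :=
  Seq (setr 6 (Const 1)) (Seq (Put 2 (Const 0) (Const 1))
    (Seq (While collect_cond collect_body)
      (Seq (setr 1 (Const 0)) (Seq (setr 2 (Const 1))
        (While machine_cond machine_body))))).

(** * Effect of the elementary commands on the abstract memory *)

Lemma exec_seq c d s : exec I (Seq c d) s = exec I d (exec I c s).
Proof. by []. Qed.

Lemma exec_if e c d s :
  exec I (If e c d) s = if eval I s e != 0 then exec I c s else exec I d s.
Proof. by []. Qed.

Lemma evalE s :
  (forall x, eval I s (Const x) = x) *
  (forall x y, eval I s (Add x y) = eval I s x + eval I s y) *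
  (forall x y, eval I s (Defs.Sub x y) = eval I s x - eval I s y) *
  (forall x y, eval I s (Eqb x y) = (eval I s x == eval I s y)) *
  (forall x y, eval I s (Leb x y) = (eval I s x <= eval I s y)).
Proof. by []. Qed.

Lemma eval_read s p x y : eval I s (Read p x y) = I p (eval I s x) (eval I s y).
Proof. by []. Qed.

Lemma eval_get s a x : eval I s (Get a x) = s a (eval I s x).
Proof. by []. Qed.

Lemma eqb0 (b : bool) : ((b : nat) != 0) = b.
Proof. by case: b. Qed.

Lemma exec_setr i e s r ev cs stk :
  stores s r ev cs stk -> i < 5 ->
  stores (exec I (setr i e) s) (set_nth 0 r i (eval I s e)) ev cs stk.
Proof. by move=> H i5; apply: stores_put_reg. Qed.

Lemma exec_setf a e s r ev cs fr stk :
  stores s r ev cs (fr :: stk) -> 7 < a <= 8 + size fr ->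
  stores (exec I (setf a e) s) r ev cs (set_nth 0 fr (a - 8) (eval I s e) :: stk).
Proof.
move=> H /andP[a8 le_a] /=; rewrite (stores_sp H) /=.
by rewrite -{1}(subnKC a8) addSn -addnS; apply: stores_put_frame => //; lia.
Qed.

Lemma exec_put_env i e s r ev cs stk :
  stores s r ev cs stk ->
  stores (exec I (Put 1 i e) s) r
    (fun z => if z == eval I s i then eval I s e else ev z) cs stk.
Proof. exact: stores_put_env. Qed.

Lemma exec_push s r ev cs stk :
  stores s r ev cs stk ->
  stores (exec I (setr 5 (Add (reg 5) (Const 1))) s) r ev cs ([::] :: stk).
Proof. by move=> H /=; rewrite (stores_sp H) addn1; apply: stores_push. Qed.

Lemma exec_pop s r ev cs fr stk :
  stores s r ev cs (fr :: stk) -> stores (exec I pop s) r ev cs stk.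
Proof. by move=> H /=; rewrite (stores_sp H) subn1; apply: stores_pop H. Qed.

Lemma exec_push_cand s r ev cs stk :
  stores s r ev cs stk ->
  stores (exec I push_cand s) r ev (rcons cs (nth 0 r 3)) stk.
Proof.
move=> H; move: (stores_push_cand (nth 0 r 3) H).
by rewrite -[nth 0 r 3](stores_reg H) //= -(stores_mark H) -(stores_nc H) !addn1.
Qed.

Lemma exec_pop_cand s r ev cs stk :
  stores s r ev (rcons cs (nth 0 r 3)) stk ->
  stores (exec I pop_cand s) r ev cs stk.
Proof.
move=> H; move: (stores_pop_cand H).
have -> : count_mem (nth 0 r 3) cs = s 2 (nth 0 r 3) - 1.
  by rewrite (stores_mark H) -cats1 count_cat /= eqxx addn0 addnK.
have -> : size cs = s 0 6 - 1 by rewrite (stores_nc H) size_rcons subn1.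
by rewrite -[nth 0 r 3](stores_reg H).
Qed.

Lemma regE s r ev cs stk i :
  stores s r ev cs stk -> i < 5 -> eval I s (reg i) = nth 0 r i.
Proof. by move=> H i5; rewrite /= (stores_reg H). Qed.

Lemma fieldE s r ev cs fr stk f :
  stores s r ev cs (fr :: stk) -> 7 < f < 8 + size fr ->
  eval I s (field f) = nth 0 fr (f - 8).
Proof.
move=> [h1 h2 h3 h4 h5 h6 [h7 _]] f8; rewrite /= h2 -h7; last by lia.
by rewrite subnKC //; lia.
Qed.

End Memory.

Arguments regE {I s r ev cs stk i}.
Arguments fieldE {I s r ev cs fr stk f}.

(** * Evaluation of a formula *)

(* Replaces the store after a command by an arbitrary one known only through its invariant, so that
   terms do not grow along a program. *)
Tactic Notation "step" constr(L) "as" ident(s) ident(H) :=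
  pose proof L as H; match type of H with stores (exec ?I ?c ?s0) _ _ _ _ =>
    revert H; generalize (exec I c s0); intros s H end.

Definition enc {n} (o : option 'I_n) : nat := if o is Some v then v.+1 else 0.

Lemma enc_inj n : injective (@enc n).
Proof. by case=> [u|] [v|] //= [/val_inj ->]. Qed.

Section Evaluation.
Variables (n k m : nat) (G : lcgraph 'I_n 'I_k 'I_m) (phi0 : fo 'I_k 'I_m).
Variable (B : seq (seq 'I_n)).
Notation I := (instance G B phi0).

Implicit Types (e : env 'I_n) (os : seq (option 'I_n)) (stk : seq (seq nat))
  (t : term 'I_k) (phi : fo 'I_k 'I_m).

Notation snapshot s v p md a b e os stk :=
  (stores s [:: v; p; md; a; b] (enc \o e) (map enc os) stk).

Lemma symbolE s r ev cs stk l i :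
  stores s r ev cs stk -> drop (nth 0 r 1) (code phi0) = l ->
  eval I s (symbol i) = nth 0 l i.
Proof. by move=> H <-; rewrite nth_drop /= (stores_reg H). Qed.

#[global] Arguments exec : simpl never.
#[global] Arguments eval : simpl never.
#[global] Arguments instance : simpl never.

Lemma mode_eval s v p a b ev cs stk :
  stores s [:: v; p; 1; a; b] ev cs stk ->
  exec I machine_body s = exec I eval_cmd s.
Proof. by move=> H; rewrite /machine_body exec_if !evalE eqb0 (regE H). Qed.

Lemma mode_next s v p a b ev cs stk :
  stores s [:: v; p; 2; a; b] ev cs stk ->
  exec I machine_body s = exec I next_cmd s.
Proof.
move=> H; rewrite /machine_body exec_if !evalE eqb0 (regE H) //=.
by rewrite exec_if !evalE eqb0 (regE H).
Qed.

Lemma mode_return s v p a b ev cs stk :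
  stores s [:: v; p; 0; a; b] ev cs stk ->
  exec I machine_body s = exec I return_cmd s.
Proof.
move=> H; rewrite /machine_body exec_if !evalE eqb0 (regE H) //=.
by rewrite exec_if !evalE eqb0 (regE H).
Qed.

Lemma condE s v p md a b ev cs stk :
  stores s [:: v; p; md; a; b] ev cs stk -> eval I s machine_cond = md + size stk.
Proof. by move=> H; rewrite evalE (regE H) // -(stores_sp H). Qed.

Lemma exec_load s r e cs stk t off i :
  stores s r (enc \o e) cs stk -> i < 5 ->
  (forall j, j < 2 -> nth 0 (drop (nth 0 r 1) (code phi0)) (off + j) = nth 0 (term_code t) j) ->
  stores (exec I (load i off) s) (set_nth 0 r i (enc (term_sem G e t))) (enc \o e) cs stk.
Proof.
move=> H i5 read; rewrite /load exec_if (symbolE off H erefl).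
have := read 0 isT; have := read 1 isT; rewrite addn0 addn1 => {}read ->.
case: t read => [x | c] /= read.
  step (exec_setr I (Get 1 (symbol off.+1)) H i5) as s1 H1.
  by move: H1; rewrite eval_get (symbolE _ H erefl) read (stores_env H).
step (exec_setr I (Add (Read PLabel (symbol off.+1) (Const 0)) (Const 1)) H i5) as s1 H1.
by move: H1; rewrite !evalE eval_read (symbolE _ H erefl) /instance read /= valK addn1.
Qed.

Definition answered v p e os stk s := exists a b, snapshot s v p 0 a b e os stk.

Lemma edgeE (u w : 'I_n) : I PEdge u w = edge G u w.
Proof. by rewrite /instance /= !valK. Qed.

Lemma colorE (c : 'I_m) (w : 'I_n) : I PColor c w = (w \in col G c).
Proof. by rewrite /instance /= !valK. Qed.

Lemma block_vertexE j z u :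
  onth (nth [::] B j) z = Some u -> I PBlockVertex j z = u.
Proof.
by move=> zu; rewrite /instance (nth_map u) -?onthTE ?zu // (@onth_nth _ u u _ _ zu).
Qed.

(** * Single rounds of the stack machine *)

Notation reaches := (leads I machine_cond machine_body).

Definition atom_sem (adj : bool) (o1 o2 : option 'I_n) : bool :=
  if (o1, o2) is (Some u, Some v) then if adj then edge G u v else u == v
  else false.

Lemma step_atom2 s v p a b e os stk (adj : bool) t1 t2 post :
  snapshot s v p 1 a b e os stk ->
  drop p (code phi0) = (adj : nat) :: (term_code t1 ++ term_code t2) ++ post ->
  reaches 1 s (answered (atom_sem adj (term_sem G e t1) (term_sem G e t2)) (p + 5) e os stk).
Proof.
move=> H D; apply: leads1; first by rewrite (condE H).
rewrite (mode_eval H) /eval_cmd exec_if !evalE eqb0 (symbolE _ H D) leq_b1.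
rewrite /atom2 !exec_seq.
have L1 : snapshot (exec I (load 3 1) s) v p 1 (enc (term_sem G e t1)) b e os stk.
  by apply: (exec_load (t := t1) H) => // -[|[|j]] // _; rewrite D; case: (t1).
step L1 as s1 H1.
have L2 : snapshot (exec I (load 4 3) s1) v p 1
    (enc (term_sem G e t1)) (enc (term_sem G e t2)) e os stk.
  by apply: (exec_load (t := t2) H1) => // -[|[|j]] // _; rewrite D; case: (t1); case: (t2).
step L2 as s2 H2.
set c := If _ _ _.
have V : snapshot (exec I c s2)
    (nat_of_bool (atom_sem adj (term_sem G e t1) (term_sem G e t2))) p 1
    (enc (term_sem G e t1)) (enc (term_sem G e t2)) e os stk.
  rewrite /c !exec_if !evalE !eqb0 !(regE H2) // (symbolE _ H2 D) /=.
  case: (term_sem G e t1) H2 => [u|] H2; last exact: stores_put_reg H2.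
  case: (term_sem G e t2) H2 => [w|] H2 /=; last exact: stores_put_reg H2.
  case: (adj) => /=.
    step (exec_setr I
      (Read PEdge (Defs.Sub (reg 3) (Const 1)) (Defs.Sub (reg 4) (Const 1)))
      H2 (isT : 0 < 5)) as s3 H3.
    by move: H3; rewrite eval_read !evalE !(regE H2) //= !subn1 edgeE.
  step (exec_setr I (Eqb (reg 3) (reg 4)) H2 (isT : 0 < 5)) as s3 H3.
  by move: H3; rewrite !evalE !(regE H2).
step V as s3 H3.
step (exec_setr I (Add (reg 1) (Const 5)) H3 (isT : 1 < 5)) as s4 H4.
step (exec_setr I (Const 0) H4 (isT : 2 < 5)) as s5 H5.
by move: H5; rewrite /= !evalE (regE H3); eexists; eexists; exact: H5.
Qed.

(** Register 0 is meaningful in return mode only, so here it is hidden along with the scratch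
    registers. *)
Definition evaluating p e os stk s := exists v a b, snapshot s v p 1 a b e os stk.
Definition choosing p e os stk s := exists v a b, snapshot s v p 2 a b e os stk.

Lemma step_atom1 s v p a b e os stk t (c : 'I_m) post :
  snapshot s v p 1 a b e os stk ->
  drop p (code phi0) = 2 :: term_code t ++ val c :: post ->
  reaches 1 s (answered (sat G e (ColF t c)) (p + 4) e os stk).
Proof.
move=> H D; apply: leads1; first by rewrite (condE H).
rewrite (mode_eval H) /eval_cmd exec_if !evalE eqb0 (symbolE _ H D) /=.
rewrite exec_if !evalE eqb0 (symbolE _ H D) /= /atom1 !exec_seq.
have L1 : snapshot (exec I (load 3 1) s) v p 1 (enc (term_sem G e t)) b e os stk.
  by apply: (exec_load (t := t) H) => // -[|[|j]] // _; rewrite D; case: (t).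
step L1 as s1 H1.
set c1 := If _ _ _.
have V : snapshot (exec I c1 s1) (nat_of_bool (sat G e (ColF t c))) p 1
    (enc (term_sem G e t)) b e os stk.
  rewrite /c1 exec_if !evalE !eqb0 !(regE H1) //=.
  case: (term_sem G e t) H1 => [u|] H1; last exact: stores_put_reg H1.
  step (exec_setr I (Read PColor (symbol 3) (Defs.Sub (reg 3) (Const 1)))
    H1 (isT : 0 < 5)) as s2 H2.
  move: H2; rewrite eval_read !evalE (symbolE _ H1 D) (regE H1) // subn1.
  by case: (t) => ? /=; rewrite colorE.
step V as s3 H3.
step (exec_setr I (Add (reg 1) (Const 4)) H3 (isT : 1 < 5)) as s4 H4.
step (exec_setr I (Const 0) H4 (isT : 2 < 5)) as s5 H5.
by move: H5; rewrite /= !evalE (regE H3); eexists; eexists; exact: H5.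
Qed.

(** Negation (code 3) enters its operand just as a binary connective enters its left one. *)
Lemma step_connective s v p a b e os stk op post :
  snapshot s v p 1 a b e os stk -> 2 < op < 8 -> drop p (code phi0) = op :: post ->
  reaches 1 s (evaluating p.+1 e os ([:: op] :: stk)).
Proof.
move=> H op38 D; apply: leads1; first by rewrite (condE H).
rewrite (mode_eval H) /eval_cmd exec_if !evalE eqb0 (symbolE _ H D) /= ifF; last by lia.
rewrite exec_if !evalE eqb0 (symbolE _ H D) /= ifF; last by lia.
rewrite !exec_seq; step (exec_push I H) as s1 H1.
step (exec_setf I (symbol 0) H1 (isT : 7 < 8 <= 8)) as s2 H2.
move: H2; rewrite (symbolE _ H1 D) /= => H2.
rewrite exec_if !evalE eqb0 (symbolE _ H2 D) /= ifT; last by lia.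
step (exec_setr I (Add (reg 1) (Const 1)) H2 (isT : 1 < 5)) as s3 H3.
by move: H3; rewrite /= !evalE (regE H2) // addn1; do 3!eexists; exact: H3.
Qed.

Lemma step_quantifier s v p a b e os stk op x post :
  snapshot s v p 1 a b e os stk -> 7 < op -> drop p (code phi0) = [:: op, x & post] ->
  reaches 1 s (choosing p e os ([:: op; 0; p + 2; x; 0; 0; 0] :: stk)).
Proof.
move=> H op8 D; apply: leads1; first by rewrite (condE H).
rewrite (mode_eval H) /eval_cmd exec_if !evalE eqb0 (symbolE _ H D) /= ifF; last by lia.
rewrite exec_if !evalE eqb0 (symbolE _ H D) /= ifF; last by lia.
rewrite !exec_seq; step (exec_push I H) as s1 H1.
step (exec_setf I (symbol 0) H1 (isT : 7 < 8 <= 8)) as s2 H2.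
move: H2; rewrite (symbolE _ H1 D) /= => H2.
rewrite exec_if !evalE eqb0 (symbolE _ H2 D) /= ifF; last by lia.
rewrite /enter_quant !exec_seq.
step (exec_setf I (Const 0) H2 (isT : 7 < 9 <= 9)) as s3 H3.
step (exec_setf I (Add (reg 1) (Const 2)) H3 (isT : 7 < 10 <= 10)) as s4 H4.
step (exec_setf I (symbol 1) H4 (isT : 7 < 11 <= 11)) as s5 H5.
step (exec_setf I (Const 0) H5 (isT : 7 < 12 <= 12)) as s6 H6.
step (exec_setf I (Const 0) H6 (isT : 7 < 13 <= 13)) as s7 H7.
step (exec_setf I (Const 0) H7 (isT : 7 < 14 <= 14)) as s8 H8.
step (exec_setr I (Const 2) H8 (isT : 2 < 5)) as s9 H9.
move: H9; rewrite /= !evalE (regE H3) // (symbolE _ H4 D) => H9.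
by do 3!eexists; exact: H9.
Qed.

Lemma return_not s (v : bool) p e os stk :
  answered v p e os ([:: 3] :: stk) s -> reaches 1 s (answered (~~ v) p e os stk).
Proof.
case=> a [b H]; apply: leads1; first by rewrite (condE H).
rewrite (mode_return H) /return_cmd exec_if !evalE eqb0 (fieldE H) //= !exec_seq.
step (exec_setr I (Defs.Sub (Const 1) (reg 0)) H (isT : 0 < 5)) as s1 H1.
step (exec_pop I H1) as s2 H2.
move: H2; rewrite !evalE (regE H) //= => H2; do 2!eexists.
by move: H2; case: (v); apply.
Qed.

Lemma return_left s v p e os stk op :
  3 < op < 8 -> answered v p e os ([:: op] :: stk) s ->
  reaches 1 s (evaluating p e os ([:: op + 6; v] :: stk)).
Proof.
move=> op48 [a [b H]]; apply: leads1; first by rewrite (condE H).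
rewrite (mode_return H) /return_cmd exec_if !evalE eqb0 (fieldE H) //= ifF; last by lia.
rewrite exec_if !evalE eqb0 (fieldE H) //= ifT; last by lia.
rewrite !exec_seq; step (exec_setf I (reg 0) H (isT : 7 < 9 <= 9)) as s1 H1.
step (exec_setf I (Add (field 8) (Const 6)) H1 (isT : 7 < 8 <= 10)) as s2 H2.
step (exec_setr I (Const 1) H2 (isT : 2 < 5)) as s3 H3.
by move: H3; rewrite /= !evalE (regE H) // (fieldE H1) //; do 3!eexists; exact: H3.
Qed.

Lemma return_right s c (u v : bool) p e os stk :
  answered v p e os ([:: conn_code c + 6; nat_of_bool u] :: stk) s ->
  reaches 1 s (answered (conn_sem c u v) p e os stk).
Proof.
case=> a [b H]; apply: leads1; first by rewrite (condE H).
rewrite (mode_return H) /return_cmd exec_if !evalE eqb0 (fieldE H) //= ifF; last by case: (c).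
rewrite exec_if !evalE eqb0 (fieldE H) //= ifF; last by case: (c).
rewrite exec_if !evalE eqb0 (fieldE H) //= ifF; last by case: (c).
rewrite exec_seq.
have V : stores (exec I (apply_connective (setr 0)) s) [:: nat_of_bool (conn_sem c u v); p; 0; a; b]
    (enc \o e) (map enc os) ([:: conn_code c + 6; nat_of_bool u] :: stk).
  rewrite /apply_connective; case: c H => H.
  - rewrite exec_if !evalE (fieldE H) //=.
    step (exec_setr I (Eqb (Add (field 9) (reg 0)) (Const 2)) H (isT : 0 < 5)) as s1 H1.
    by move: H1; rewrite !evalE (fieldE H) // (regE H) //=; case: (u); case: (v).
  - do 2![rewrite exec_if !evalE (fieldE H) //=].
    step (exec_setr I (Leb (Const 1) (Add (field 9) (reg 0))) H (isT : 0 < 5)) as s1 H1.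
    by move: H1; rewrite !evalE (fieldE H) // (regE H) //=; case: (u); case: (v).
  - do 3![rewrite exec_if !evalE (fieldE H) //=].
    step (exec_setr I (Leb (field 9) (reg 0)) H (isT : 0 < 5)) as s1 H1.
    by move: H1; rewrite !evalE (fieldE H) // (regE H) //=; case: (u); case: (v).
  do 3![rewrite exec_if !evalE (fieldE H) //=].
  step (exec_setr I (Eqb (field 9) (reg 0)) H (isT : 0 < 5)) as s1 H1.
  by move: H1; rewrite !evalE (fieldE H) // (regE H) //=; case: (u); case: (v).
step V as s1 H1; step (exec_pop I H1) as s2 H2.
by do 2!eexists; exact: H2.
Qed.

(** Unlike [upd], this can also unbind [x], as the dummy candidate does. *)
Definition bind e x (o : option 'I_n) : env 'I_n := fun y => if y == x then o else e y.

Definition is_ex (op : nat) : bool := op == 8.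

(** The candidate to be removed is recovered from the environment, where it is still the value of
    [x]; the eighth field then restores the outer value and is dropped. *)
Lemma return_body s (r acc : bool) p e (x : nat) o os stk (op body i j t : nat) :
  7 < op < 10 ->
  answered r p (bind e x o) (rcons os o)
    ([:: op; nat_of_bool acc; body; x; i; j; t; enc (e x)] :: stk) s ->
  reaches 1 s (choosing p e os
    ([:: op; nat_of_bool (acc || (isSome o && (r == is_ex op))); body; x; i; j; t] :: stk)).
Proof.
move=> op89 [a [b H]]; apply: leads1; first by rewrite (condE H).
rewrite (mode_return H) /return_cmd exec_if !evalE eqb0 (fieldE H) //= ifF; last by lia.
rewrite exec_if !evalE eqb0 (fieldE H) //= ifF; last by lia.
rewrite exec_if !evalE eqb0 (fieldE H) //= ifT; last by lia.
rewrite /leave_body 4!exec_seq.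
step (exec_setr I (Get 1 (field 11)) H (isT : 3 < 5)) as s1 H1.
move: H1; rewrite eval_get (fieldE H) //= (stores_env H) /= /bind eqxx => H1.
step (exec_put_env I (field 11) (field 15) H1) as s2 H2.
move: H2; rewrite map_rcons !(fieldE H1) //= => H2.
step (exec_pop_cand I H2) as s3 H3.
have {}H2: stores s3 [:: nat_of_bool r; p; 0; enc o; b] (enc \o e) (map enc os)
    ([:: op; nat_of_bool acc; body; x; i; j; t; enc (e x)] :: stk).
  by apply: stores_env_eq H3 => y /=; case: eqP => [->|].
set c := If _ _ _.
have V : stores (exec I c s3) [:: nat_of_bool r; p; 0; enc o; b] (enc \o e) (map enc os)
  ([:: op; nat_of_bool (acc || (isSome o && (r == is_ex op))); body; x; i; j; t; enc (e x)] :: stk).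
  rewrite /c exec_if (regE H2) //=.
  case: o {H H1 H3} H2 => [w|] /= H2; last by rewrite orbF.
  rewrite exec_if !evalE eqb0 (regE H2) // (fieldE H2) //=.
  have -> : ((r : nat) == (op == 8)) = (r == is_ex op).
    by rewrite /is_ex; case: (r); case: (op == 8).
  case: eqP => _.
    rewrite orbT; exact: (exec_setf I (Const 1) H2 (isT : 7 < 9 <= 16)).
  by rewrite orbF.
step V as s4 H4; step (exec_setr I (Const 2) (stores_take_frame 7 H4) (isT : 2 < 5)) as s5 H5.
by do 3!eexists; exact: H5.
Qed.

Lemma exec_enter_body s v p md b e o os stk (op acc body x i j z : nat) :
  snapshot s v p md (enc o) b e os ([:: op; acc; body; x; i; j; z] :: stk) ->
  evaluating body (bind e x o) (rcons os o)
    ([:: op; acc; body; x; i; j; z; enc (e x)] :: stk) (exec I enter_body s).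
Proof.
move=> H; rewrite /enter_body 4!exec_seq.
step (exec_setf I (Get 1 (field 11)) H (isT : 7 < 15 <= 15)) as s1 H1.
move: H1; rewrite eval_get (fieldE H) //= (stores_env H) /= => H1.
step (exec_put_env I (field 11) (reg 3) H1) as s2 H2.
move: H2; rewrite (fieldE H1) // (regE H1) //= => H2.
step (exec_push_cand I H2) as s3 H3.
step (exec_setr I (field 10) H3 (isT : 1 < 5)) as s4 H4.
step (exec_setr I (Const 1) H4 (isT : 2 < 5)) as s5 H5.
move: H5; rewrite (fieldE H3) //= -map_rcons => H5.
exists v, (enc o), b; apply: stores_env_eq H5 => y /=.
by rewrite /bind; case: (y == x).
Qed.

Lemma next_old s p e os stk (op acc body x i j z : nat) :
  i < size os ->
  choosing p e os ([:: op; acc; body; x; i; j; z] :: stk) s ->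
  reaches 1 s (evaluating body (bind e x (nth None os i)) (rcons os (nth None os i))
    ([:: op; acc; body; x; i.+1; j; z; enc (e x)] :: stk)).
Proof.
move=> lt_i [v [a [b H]]]; apply: leads1; first by rewrite (condE H).
have nc s' r ev stk' : stores s' r ev (map enc os) stk' -> eval I s' (reg 6) = size os.
  by move=> H'; rewrite eval_get [eval _ _ _]/eval (stores_nc H') size_map.
rewrite (mode_next H) /next_cmd exec_if !evalE eqb0 (fieldE H) // (nc _ _ _ _ H) addn1 lt_i.
rewrite !exec_seq; step (exec_setr I (Get 3 (field 12)) H (isT : 3 < 5)) as s1 H1.
move: H1; rewrite eval_get (fieldE H) // (stores_cand H) ?size_map // (nth_map None) //= => H1.
step (exec_setf I (Add (field 12) (Const 1)) H1 (isT : 7 < 12 <= 15)) as s2 H2.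
move: H2; rewrite !evalE (fieldE H1) // addn1 => H2.
exact: exec_enter_body H2.
Qed.

Lemma exec_next_block s r ev cs stk (op acc body x i j z : nat) :
  stores s r ev cs ([:: op; acc; body; x; i; j; z] :: stk) ->
  stores (exec I next_block s) r ev cs ([:: op; acc; body; x; i; j.+1; 0] :: stk).
Proof.
move=> H; rewrite /next_block exec_seq.
step (exec_setf I (Add (field 13) (Const 1)) H (isT : 7 < 13 <= 15)) as s1 H1.
move: H1; rewrite !evalE (fieldE H) // addn1 => H1.
exact: (exec_setf I (Const 0) H1 (isT : 7 < 14 <= 15)).
Qed.

Section Blocks.
Variables (s : store) (v p a b : nat) (e : env 'I_n) (os : seq (option 'I_n))
  (stk : seq (seq nat)) (op acc body x j z : nat).
Hypothesis H :
  snapshot s v p 2 a b e os ([:: op; acc; body; x; size os; j; z] :: stk).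

Lemma exec_blocks :
  exec I machine_body s =
  if j < size B then
    if z < size (nth [::] B j) then
      exec I (Seq (setr 3 (Add (Read PBlockVertex (field 13) (field 14)) (Const 1)))
        (If (Get 2 (reg 3)) (setf 14 (Add (field 14) (Const 1)))
          (Seq next_block enter_body))) s
    else exec I next_block s
  else exec I (Seq (setr 0 (Eqb (field 9) (Eqb (field 8) (Const 8))))
                (Seq pop (setr 2 (Const 0)))) s.
Proof.
rewrite (mode_next H) /next_cmd exec_if !evalE eqb0 (fieldE H) // addn1.
rewrite eval_get [eval _ _ _]/eval (stores_nc H) size_map ltnn.
rewrite exec_if !evalE eqb0 (fieldE H) // addn1 eval_read.
by rewrite exec_if !evalE eqb0 (fieldE H) // addn1 eval_read (fieldE H) ?negbK.
Qed.

Lemma next_marked u :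
  onth (nth [::] B j) z = Some u -> j < size B -> Some u \in os ->
  reaches 1 s (choosing p e os ([:: op; acc; body; x; size os; j; z.+1] :: stk)).
Proof.
move=> zu lt_j u_os; apply: leads1; first by rewrite (condE H).
have lt_z : z < size (nth [::] B j) by rewrite -onthTE zu.
rewrite exec_blocks lt_j lt_z exec_seq.
step (exec_setr I (Add (Read PBlockVertex (field 13) (field 14)) (Const 1))
  H (isT : 3 < 5)) as s1 H1.
move: H1; rewrite !evalE eval_read !(fieldE H) // (block_vertexE zu) addn1 /= => H1.
rewrite exec_if eval_get (stores_mark H1) (regE H1) //= -lt0n -has_count has_pred1.
rewrite -[(val u).+1]/(enc (Some u)) (mem_map (@enc_inj n)) u_os.
step (exec_setf I (Add (field 14) (Const 1)) H1 (isT : 7 < 14 <= 15)) as s2 H2.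
by move: H2; rewrite !evalE (fieldE H1) // addn1; do 3!eexists; exact: H2.
Qed.

Lemma next_fresh u :
  onth (nth [::] B j) z = Some u -> j < size B -> Some u \notin os ->
  reaches 1 s (evaluating body (bind e x (Some u)) (rcons os (Some u))
    ([:: op; acc; body; x; size os; j.+1; 0; enc (e x)] :: stk)).
Proof.
move=> zu lt_j u_os; apply: leads1; first by rewrite (condE H).
have lt_z : z < size (nth [::] B j) by rewrite -onthTE zu.
rewrite exec_blocks lt_j lt_z exec_seq.
step (exec_setr I (Add (Read PBlockVertex (field 13) (field 14)) (Const 1))
  H (isT : 3 < 5)) as s1 H1.
move: H1; rewrite !evalE eval_read !(fieldE H) // (block_vertexE zu) addn1 /= => H1.
rewrite exec_if eval_get (stores_mark H1) (regE H1) //= -lt0n -has_count has_pred1.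
rewrite -[(val u).+1]/(enc (Some u)) (mem_map (@enc_inj n)) (negbTE u_os) exec_seq.
step (exec_next_block H1) as s2 H2.
exact: (exec_enter_body (o := Some u) H2).
Qed.

Lemma next_end :
  j < size B -> size (nth [::] B j) <= z ->
  reaches 1 s (choosing p e os ([:: op; acc; body; x; size os; j.+1; 0] :: stk)).
Proof.
move=> lt_j le_z; apply: leads1; first by rewrite (condE H).
rewrite exec_blocks lt_j ltnNge le_z /=.
by exists v, a, b; apply: exec_next_block H.
Qed.

Lemma next_finish :
  size B <= j -> reaches 1 s (answered (acc == is_ex op) p e os stk).
Proof.
move=> le_j; apply: leads1; first by rewrite (condE H).
rewrite exec_blocks ltnNge le_j /= !exec_seq.
step (exec_setr I (Eqb (field 9) (Eqb (field 8) (Const 8))) H (isT : 0 < 5)) as s1 H1.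
step (exec_pop I H1) as s2 H2.
step (exec_setr I (Const 0) H2 (isT : 2 < 5)) as s3 H3.
by move: H3; rewrite /= !evalE !(fieldE H) //; do 2!eexists; exact: H3.
Qed.

End Blocks.

(** * The search carried out for one quantifier *)

Section Quantifier.
Variables (e : env 'I_n) (x : nat) (os : seq (option 'I_n)) (stk : seq (seq nat)).
Variables (f : fo 'I_k 'I_m) (op body after T : nat).
Hypothesis op89 : 7 < op < 10.
Hypothesis body_ok : forall o stk' s,
  evaluating body (bind e x o) (rcons os o) stk' s ->
  reaches T s (answered (sat G (bind e x o) f) after (bind e x o) (rcons os o) stk').

(** Witnesses for an existential and counterexamples for a universal quantifier: both kinds become
    one search. *)
Let Q (v : 'I_n) := sat G (upd e x v) f == is_ex op.

Lemma try_one s (acc : bool) o (i j z : nat) :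
  evaluating body (bind e x o) (rcons os o)
    ([:: op; nat_of_bool acc; body; x; i; j; z; enc (e x)] :: stk) s ->
  reaches T.+1 s (choosing after e os
    ([:: op; nat_of_bool (acc || hits Q o); body; x; i; j; z] :: stk)).
Proof.
move=> /body_ok; rewrite -addn1 => h; apply: leads_seq h _ => s' h'.
by move: (return_body op89 h'); case: (o).
Qed.

(** [T.+2] is the body plus one round to enter and one to leave it. The position becomes [after]
    with the first candidate tried, hence the disjunction. *)
Lemma try_old r i (acc : bool) s pos :
  i + r = size os -> 0 < r \/ pos = after ->
  choosing pos e os ([:: op; nat_of_bool acc; body; x; i; 0; 0] :: stk) s ->
  reaches (r * T.+2) s (choosing after e os
    ([:: op; nat_of_bool (acc || has (hits Q) (drop i os)); body; x; size os; 0; 0] :: stk)).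
Proof.
elim: r i acc s pos => [|r IH] i acc s pos sz_os h H.
  rewrite addn0 in sz_os; rewrite sz_os drop_size orbF in H *.
  by apply: leads0; case: h H => // ->.
have lt_i : i < size os by lia.
rewrite mulSn -add1n -addnA; apply: leads_seq (next_old lt_i H) _ => s1 H1.
apply: leads_seq (try_one H1) _ => s2 H2.
rewrite (drop_nth None lt_i) /= orbA; apply: IH H2; first by lia.
by right.
Qed.

(** Every old vertex costs one round to skip; [T.+2] pays for the fresh vertex, or for noticing the
    end of the block. *)
Lemma try_block j z (acc : bool) s b :
  j < size B -> drop z (nth [::] B j) = b ->
  choosing after e os ([:: op; nat_of_bool acc; body; x; size os; j; z] :: stk) s ->
  reaches (count (fun v => Some v \in os) b + T.+2) s (choosing after e os
    ([:: op; nat_of_bool (acc || hits Q (fresh os b)); body; x; size os; j.+1; 0] :: stk)).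
Proof.
move=> lt_j; elim: b z s => [|u b IH] z s def_b [v [a [c H]]].
  rewrite orbF; apply: (leads_le (T := 1)) => //.
  by apply: next_end H lt_j _; rewrite -subn_eq0 -size_drop def_b.
have zu : onth (nth [::] B j) z = Some u.
  by rewrite onthE -[z]addn0 -nth_drop -map_drop def_b.
rewrite /fresh /=; have [u_os | u_os] := boolP (Some u \in os).
  rewrite -addnA; apply: leads_seq (next_marked H zu lt_j u_os) _ => s1 H1.
  by apply: IH H1; rewrite -addn1 addnC -drop_drop def_b /= drop0.
apply: (leads_le (T := 1 + T.+1)); first by rewrite add1n leq_addl.
apply: leads_seq (next_fresh H zu lt_j u_os) _ => s1 H1.
exact: try_one H1.
Qed.

Lemma try_blocks j (acc : bool) s Bs :
  drop j B = Bs ->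
  choosing after e os ([:: op; nat_of_bool acc; body; x; size os; j; 0] :: stk) s ->
  reaches (count (fun v => Some v \in os) (flatten Bs) + size Bs * T.+2) s
    (fun s' => exists2 j', size B <= j' & choosing after e os
      ([:: op; nat_of_bool (acc || has (fun b => hits Q (fresh os b)) Bs);
           body; x; size os; j'; 0] :: stk) s').
Proof.
elim: Bs j acc s => [|b Bs IH] j acc s defB H.
  apply: leads0; exists j; last by rewrite orbF.
  by rewrite -subn_eq0 -size_drop defB.
have lt_j : j < size B by rewrite ltnNge -subn_eq0 -size_drop defB.
have def_b : drop 0 (nth [::] B j) = b.
  by rewrite drop0 -[j]addn0 -nth_drop defB.
rewrite /= count_cat mulSn addnACA; apply: leads_seq (try_block lt_j def_b H) _ => s1 H1.
rewrite orbA; apply: IH H1.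
by rewrite -addn1 addnC -drop_drop defB /= drop0.
Qed.

Lemma try_all s pos :
  0 < size os ->
  choosing pos e os ([:: op; 0; body; x; 0; 0; 0] :: stk) s ->
  reaches (size os * T.+2 +
           (count (fun v => Some v \in os) (flatten B) + size B * T.+2) + 1) s
    (answered
      ((has (hits Q) os || has (fun b => hits Q (fresh os b)) B) == is_ex op)
      after e os stk).
Proof.
move=> os0 H; apply: leads_seq.
  apply: leads_seq.
    by apply: (try_old (acc := false) (i := 0)) H => //; left.
  by move=> s1 H1; apply: try_blocks H1; rewrite drop0.
move=> s' [j le_j [v [a [b H']]]]; have := next_finish H' le_j.
by rewrite drop0 /=; do 2!case: has; case: (is_ex op).
Qed.

End Quantifier.

(** * Correctness and number of rounds of the evaluation *)

Section Correctness.
Variables (P : {set {set 'I_n}}) (N : nat).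
Hypotheses (BP : lists_partition B P) (partP : partition P [set: 'I_n]).
Hypothesis typP :
  forall S v v', S \in P -> v \in S -> v' \in S -> same_type G v v'.
Hypothesis N_gt0 : 0 < N.

(** Binding a variable adds one candidate and lowers the quantifier depth by one, so the bound
    [N.+1] is inherited by the body; its extra one accounts for the dummy candidate. *)
Lemma evaluating_correct f e os stk p post s :
  drop p (code phi0) = code f ++ post ->
  (forall a : 'I_k, val a \in code f -> Some (lab G a) \in os) ->
  (forall x v, e x = Some v -> Some v \in os) ->
  0 < size os -> size os + size B + qdepth f <= N.+1 ->
  evaluating p e os stk s ->
  reaches (5 * N ^ qdepth f * flen f) s (answered (sat G e f) (p + size (code f)) e os stk).
Proof.
have N_expn d : 0 < N ^ d by rewrite expn_gt0 N_gt0.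
elim: f e os stk p post s => [t1 t2|t c|t1 t2|f IH|c f1 IH1 f2 IH2|b x f IH]
  e os stk p post s D labs bound os_gt0 le_N [v [a [b' H]]].
- have -> : p + size (code (AdjF _ t1 t2 : fo 'I_k 'I_m)) = p + 5.
    by case: (t1); case: (t2).
  by apply: leads_le (step_atom2 (adj := true) H D).
- have -> : p + size (code (ColF t c : fo 'I_k 'I_m)) = p + 4 by case: (t).
  apply: leads_le (step_atom1 (c := c) (t := t) (post := post) H _) => //.
  by rewrite D /= cat_rcons.
- have -> : p + size (code (EqF _ t1 t2 : fo 'I_k 'I_m)) = p + 5.
    by case: (t1); case: (t2).
  by apply: leads_le (step_atom2 (adj := false) H D).
- have D1 : drop p.+1 (code phi0) = code f ++ post by rewrite -add1n -drop_drop D /= drop0.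
  have labs1 (l : 'I_k) : val l \in code f -> Some (lab G l) \in os.
    by move=> h; apply: labs; rewrite inE h orbT.
  apply: (leads_le (T := 1 + (5 * N ^ qdepth f * flen f + 1))).
    by rewrite /= mulnS; have := N_expn (qdepth f); lia.
  apply: leads_seq (step_connective H _ D) _ => // s1 H1.
  apply: leads_seq (IH _ _ _ _ _ _ D1 labs1 bound os_gt0 le_N H1) _ => s2 H2.
  by rewrite /= addnS; apply: return_not H2.
- have D1 : drop p.+1 (code phi0) = code f1 ++ (code f2 ++ post).
    by rewrite -add1n -drop_drop D /= drop0 catA.
  have D2 : drop (p.+1 + size (code f1)) (code phi0) = code f2 ++ post.
    by rewrite addnC -drop_drop D1 drop_size_cat.
  have labs1 (l : 'I_k) : val l \in code f1 -> Some (lab G l) \in os.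
    by move=> h; apply: labs; rewrite inE mem_cat h orbT.
  have labs2 (l : 'I_k) : val l \in code f2 -> Some (lab G l) \in os.
    by move=> h; apply: labs; rewrite inE mem_cat h !orbT.
  have le_N1 : size os + size B + qdepth f1 <= N.+1 by rewrite /= in le_N; lia.
  have le_N2 : size os + size B + qdepth f2 <= N.+1 by rewrite /= in le_N; lia.
  set T1 := 5 * N ^ qdepth f1 * flen f1; set T2 := 5 * N ^ qdepth f2 * flen f2.
  (* The three rounds beyond the operands enter the formula, switch to the right operand and combine
     the values; the symbol of the connective pays for them. *)
  apply: (leads_le (T := 1 + (T1 + (1 + (T2 + 1))))).
    rewrite /= mulnS mulnDr; set M := N ^ maxn _ _.
    have le1 : T1 <= 5 * M * flen f1.
      by rewrite leq_mul2r leq_mul2l leq_pexp2l ?leq_maxl ?orbT.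
    have le2 : T2 <= 5 * M * flen f2.
      by rewrite leq_mul2r leq_mul2l leq_pexp2l ?leq_maxr ?orbT.
    have := N_expn (maxn (qdepth f1) (qdepth f2)); rewrite -/M; lia.
  have op48 : 3 < conn_code c < 8 by case: (c).
  apply: leads_seq (step_connective H _ D) _ => [|s1 H1]; first by lia.
  apply: leads_seq (IH1 _ _ _ _ _ _ D1 labs1 bound os_gt0 le_N1 H1) _ => s2 H2.
  apply: leads_seq (return_left op48 H2) _ => s3 H3.
  apply: leads_seq (IH2 _ _ _ _ _ _ D2 labs2 bound os_gt0 le_N2 H3) _ => s4 H4.
  by rewrite /= size_cat addnS -addSn addnA; apply: return_right H4.
have D1 : drop (p + 2) (code phi0) = code f ++ post.
  by rewrite addnC -drop_drop D /= drop0.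
have labs1 (l : 'I_k) : val l \in code f -> Some (lab G l) \in os.
  by move=> h; apply: labs; rewrite !inE h !orbT.
set T := 5 * N ^ qdepth f * flen f.
have body_ok o stk' s' :
    evaluating (p + 2) (bind e x o) (rcons os o) stk' s' ->
    reaches T s' (answered (sat G (bind e x o) f) (p + 2 + size (code f))
      (bind e x o) (rcons os o) stk').
  apply: IH D1 _ _ _ _; rewrite ?size_rcons //.
  - by move=> l /labs1; rewrite mem_rcons inE => ->; rewrite orbT.
  - move=> y w; rewrite /bind mem_rcons inE; case: eqP => [_ ->|_ /bound ->].
      by rewrite eqxx.
    by rewrite orbT.
  by rewrite /= in le_N; lia.
have twins u w : same_type G u w -> Some u \notin os -> Some w \notin os ->
    sat G (upd e x u) f = sat G (upd e x w) f.
  by move=> uw nu nw; apply: sat_twins uw nu nw labs1 bound.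
have op89 : 7 < quant_code b < 10 by case: (b).
pose Q v := sat G (upd e x v) f == is_ex (quant_code b).
have -> : sat G e (QuantF b x f) =
    ((has (hits Q) os || has (fun b => hits Q (fresh os b)) B) == is_ex (quant_code b)).
  rewrite -(exists_hits BP partP typP); last by move=> u w uw nu nw; rewrite /Q (twins u w).
  rewrite /Q; case: b {H D labs le_N IH body_ok op89 Q} => /=.
    by rewrite eqb_id; apply: eq_existsb => w; rewrite eqb_id.
  by rewrite eqbF_neg negb_exists; apply: eq_forallb => w; rewrite eqbF_neg negbK.
have := count_old BP partP os; set C := count _ _ => le_C.
(* The total is at most [N * T] for the bodies, [2 * N] for entering and leaving them, [N] for
   skipped vertices, and 2. All but the first are paid for by the 2 that the quantifier adds to
   [flen]. *)
apply: (leads_le (T := 1 + (size os * T.+2 + (C + size B * T.+2) + 1))).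
  have le_os : size os + size B <= N by rewrite /= in le_N; lia.
  have : size os * T.+2 + size B * T.+2 <= N * T.+2.
    by rewrite -mulnDl leq_mul2r le_os orbT.
  move: (size os * _) (size B * _) => X Y le_XY.
  have le_M : N <= N * N ^ qdepth f by rewrite leq_pmulr.
  rewrite /= expnS !mulnS; rewrite !mulnS in le_XY.
  have -> : 5 * (N * N ^ qdepth f) * flen f = N * T by rewrite /T; lia.
  move: (N * T) (N * N ^ _) le_XY le_M => Z W le_XY le_M.
  have := leq_trans le_C (leq_trans (leq_addr _ _) le_os).
  by clear -N_gt0 le_XY le_M; move: C => C; lia.
have {}H := step_quantifier H (proj1 (andP op89)) D.
apply: (leads_seq H) => s1 H1.
have -> : p + size (code (QuantF b x f)) = p + 2 + size (code f) by rewrite -addnA.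
exact: (try_all op89 body_ok os_gt0 H1).
Qed.

End Correctness.
End Evaluation.

(** * Collection of the labeled vertices *)

Section Collection.
Variables (n k m : nat) (G : lcgraph 'I_n 'I_k 'I_m) (phi : fo 'I_k 'I_m).
Variable (B : seq (seq 'I_n)).
Notation I := (instance G B phi).
Implicit Types (os : seq (option 'I_n)) (s : store).

Definition no_env : env 'I_n := fun _ => None.

(** The first two conditions bound the length by [l + 1]; [p] is the number of code entries already
    read. *)
Definition collected p os : Prop :=
  [/\ uniq os, {subset os <= None :: [seq Some v | v <- enum (labeled G)]}, None \in os &
      forall a : 'I_k, val a \in take p (code phi) -> Some (lab G a) \in os].

Definition collecting p os s : Prop :=
  collected p os /\
  exists a b, stores s [:: 0; p; 0; a; b] (enc \o no_env) (map enc os) [::].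

Lemma labelE (a : nat) (lt_a : a < k) x :
  I PLabel a x = lab G (Ordinal lt_a).
Proof. by rewrite /instance insubT. Qed.

Lemma step_collect p os s :
  p < size (code phi) -> collecting p os s ->
  leads I collect_cond collect_body 1 s
    (fun s' => exists os', collecting p.+1 os' s').
Proof.
move=> lt_p [[uos sub_os os0 labs] [a [b H]]].
apply: leads1; first by rewrite evalE (regE H) //= -lt0n subn_gt0.
have sym : eval I s (symbol 0) = nth 0 (code phi) p.
  by rewrite (symbolE _ _ 0 H erefl) /= nth_drop addn0.
have take_p (c : nat) : c \in take p.+1 (code phi) ->
    c = nth 0 (code phi) p \/ c \in take p (code phi).
  by rewrite (take_nth 0 lt_p) mem_rcons inE => /orP[/eqP|]; [left|right].
rewrite /collect_body 2!exec_seq.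
step (exec_setr I (symbol 0) H (isT : 4 < 5)) as s1 H1.
step (exec_setr I (Add (reg 1) (Const 1)) H1 (isT : 1 < 5)) as s2 H2.
move: H2; rewrite sym !evalE (regE H1) //= addn1 => H2.
rewrite exec_if !evalE eqb0 (regE H2) // addn1 eval_read -[I PLabels _ _]/k.
have [lt_k | ge_k] := ltnP (nth 0 (code phi) p) k; last first.
  exists os; split; last by do 2!eexists; exact: H2.
  split=> // c /take_p[def_c | /labs //].
  by move: ge_k; rewrite -def_c leqNgt ltn_ord.
rewrite exec_seq.
step (exec_setr I (Add (Read PLabel (reg 4) (Const 0)) (Const 1)) H2 (isT : 3 < 5)) as s3 H3.
move: H3; rewrite !evalE eval_read (regE H2) // labelE addn1.
set c := Ordinal _; rewrite -[(lab G c).+1]/(enc (Some (lab G c))) => H3.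
rewrite exec_if eval_get (regE H3) // (stores_mark H3) -lt0n -has_count has_pred1.
rewrite /= -[(lab G c).+1]/(enc (Some (lab G c))) (mem_map (@enc_inj _)).
have labs_c os' : {subset os <= os'} -> Some (lab G c) \in os' ->
    forall a : 'I_k, val a \in take p.+1 (code phi) -> Some (lab G a) \in os'.
  move=> sub_os' c_os' d /take_p[def_d|/labs/sub_os' //].
  by rewrite (_ : d = c) //; apply: val_inj.
case: ifPn => [c_os | c_os].
  exists os; split; last by do 2!eexists; exact: H3.
  by split=> //; apply: labs_c.
exists (rcons os (Some (lab G c))); split; last first.
  step (exec_push_cand I H3) as s4 H4.
  by move: H4; rewrite -map_rcons; do 2!eexists; exact: H4.
split.
- by rewrite rcons_uniq c_os.
- move=> o; rewrite mem_rcons inE => /predU1P[->|/sub_os //].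
  by rewrite inE /= (mem_map (@Some_inj _)) mem_enum imset_f.
- by rewrite mem_rcons inE os0 orbT.
apply: labs_c; last by rewrite mem_rcons mem_head.
by move=> o h; rewrite mem_rcons inE h orbT.
Qed.

Lemma collect_correct r p os s :
  p + r = size (code phi) -> collecting p os s ->
  leads I collect_cond collect_body r s
    (fun s' => exists os', collecting (size (code phi)) os' s').
Proof.
elim: r p os s => [|r IH] p os s sz H.
  by apply: leads0; exists os; rewrite -sz addn0.
rewrite -add1n; apply: leads_seq (step_collect _ H) _ => [|s1 [os1 H1]].
  by rewrite -sz addnS ltnS leq_addr.
by apply: IH H1; rewrite addSnnS.
Qed.

Lemma size_collected p os : collected p os -> size os <= #|labeled G|.+1.
Proof.
case=> uos sub_os _ _; have := uniq_leq_size uos sub_os.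
by rewrite /= size_map -cardE.
Qed.

End Collection.

(** * The whole program and its running time *)

Lemma size_code k m (phi : fo 'I_k 'I_m) : size (code phi) <= 2 * flen phi.
Proof.
elim: phi => [t1 t2|t c|t1 t2|f|b f1 IH1 f2 IH2|b x f] /=.
- by case: t1; case: t2.
- by case: t.
- by case: t1; case: t2.
- by lia.
- by rewrite size_cat; lia.
by lia.
Qed.

Lemma flen_gt0 k m (phi : fo 'I_k 'I_m) : 0 < flen phi.
Proof. by case: phi. Qed.

Lemma program_correct n k m (G : lcgraph 'I_n 'I_k 'I_m) (phi : fo 'I_k 'I_m)
    (P : {set {set 'I_n}}) (B : seq (seq 'I_n)) N :
  lists_partition B P -> partition P [set: 'I_n] ->
  (forall S v v', S \in P -> v \in S -> v' \in S -> same_type G v v') ->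
  0 < N -> #|labeled G| + size B + qdepth phi <= N ->
  exists t s, [/\ run (instance G B phi) program (fun _ _ => 0) t s,
    t <= 20 + (2 * flen phi).+1 * (ecost collect_cond + maxcost collect_body).+1
       + (5 * N ^ qdepth phi * flen phi).+1 * (ecost machine_cond + maxcost machine_body).+1
    & s 0 0 = models G phi :> nat].
Proof.
move=> BP partP typP N_gt0 le_N; set I := instance G B phi.
pose s2 := exec I (Put 2 (Const 0) (Const 1)) (exec I (setr 6 (Const 1)) (fun _ _ => 0)).
(* The dummy candidate is encoded by 0, which the initial memory already holds in the candidate
   list; only its count and its mark have to be set. *)
have H2 : collecting G phi 0 [:: None] s2.
  split; first by split=> // o; rewrite ?take0 // !inE => ->.
  exists 0, 0; split=> //.
  - by case=> [|[|[|[|[]]]]].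
  - by move=> v; rewrite /s2 /= /put; case: v.
  - by case.
have := collect_correct B (r := size (code phi)) (p := 0) erefl H2.
move/(leads_le (size_code phi)).
case/run_while => // [s' [os [_ [a [b H]]]]|].
  by rewrite evalE (regE H) // eval_read subnn.
move=> t3 [s3 [run3 le_t3 [os [[uos sub_os os0 labs] [a [b H3]]]]]].
pose s4 := exec I (setr 1 (Const 0)) s3; pose s5 := exec I (setr 2 (Const 1)) s4.
have H5 : evaluating 0 (no_env n) os [::] s5.
  have H4 := exec_setr I (Const 0) H3 (isT : 1 < 5).
  by do 3!eexists; exact: (exec_setr I (Const 1) H4 (isT : 2 < 5)).
have L : leads I machine_cond machine_body (5 * N ^ qdepth phi * flen phi) s5
    (answered (models G phi) (size (code phi)) (no_env n) os [::]).
  apply: (evaluating_correct (post := [::]) BP partP typP N_gt0) H5 => //.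
  - by rewrite drop0 cats0.
  - by move=> c c_phi; apply: labs; rewrite take_size.
  - by case: (os) os0.
  have := size_collected (And4 uos sub_os os0 labs); lia.
case/run_while: L => // [s' [c [d H]]|t6 [s6 [run6 le_t6 [c [d H6]]]]].
  by rewrite (condE _ _ _ H).
(* Each of the four assignments outside the loops costs 3 units. *)
exists (3 + (3 + (t3 + (3 + (3 + t6))))), s6.
split.
- by do 2!(apply: RunSeq; first exact: RunPut); apply: RunSeq run3 _;
    do 2!(apply: RunSeq; first exact: RunPut).
- by lia.
by rewrite (stores_reg H6).
Qed.

Theorem theorem1 :
  exists (c : cmd) (K : nat),
  forall (n k m : nat) (G : lcgraph 'I_n 'I_k 'I_m) (phi : fo 'I_k 'I_m)
    (q w l : nat) (P : {set {set 'I_n}}) (B : seq (seq 'I_n)),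
  sentence phi -> qdepth phi = q ->
  nd_partition G w P -> #|labeled G| = l ->
  lists_partition B P ->
  decides_in c (instance G B phi) (models G phi)
    (K * ((w + l + q) ^ q * flen phi)).
Proof.
set D1 := (ecost collect_cond + maxcost collect_body).+1.
set D2 := (ecost machine_cond + maxcost machine_body).+1.
(* With [M] the power and [F] the length, both positive, [2 * F + 1] is at most [3 * (M * F)] and
   [5 * M * F + 1] at most [6 * (M * F)]. *)
exists program, (20 + 3 * D1 + 6 * D2).
move=> n k m G phi q w l P B _ def_q [partP le_w typP] def_l BP.
(* This is the maximum of 1 and [w + l + q]. If the sum is 0 then [q = 0], and both powers equal
   1. *)
pose N := (w + l + q).-1.+1.
have le_N : #|labeled G| + size B + qdepth phi <= N.
  by rewrite (size_blocks BP) def_l def_q /N; lia.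
have N_q : N ^ qdepth phi = (w + l + q) ^ q.
  rewrite def_q /N; case E: (w + l + q) => [|u] //=.
  by have -> : q = 0 by lia.
have [t [s [run_s le_t ans]]] := program_correct BP partP typP (ltn0Sn _ : 0 < N) le_N.
exists t, s; split=> //; apply: leq_trans le_t _; rewrite N_q -/D1 -/D2.
have := flen_gt0 phi; have : 0 < (w + l + q) ^ q by rewrite -N_q expn_gt0.
move: (_ ^ q) (flen phi) D1 D2 => M F D1 D2 M0 F0.
have F_le : F <= M * F by rewrite leq_pmull.
have -> : (20 + 3 * D1 + 6 * D2) * (M * F) =
    20 * (M * F) + 3 * (M * F) * D1 + 6 * (M * F) * D2 by lia.
apply: leq_add; first apply: leq_add.
- by rewrite leq_pmulr // muln_gt0 M0.
- by rewrite leq_mul2r; apply/orP; right; lia.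
by rewrite leq_mul2r; apply/orP; right; lia.
Qed.
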